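(* Let $R$ be a left or right Noetherian ring with a derivation $\delta$. Then $$P(R((x^{-1};\delta)))=P_{\delta}(R)((x^{-1};\delta)),$$ where $P_{\delta}(R)$ is the limit of the ideals $\mathcal{I}_{l,\delta}^{(\alpha)}(R)$, that is, $P_\delta(R)=\bigcup_{\alpha}\mathcal{I}_{l,\delta}^{(\alpha)}(R)$ over all ordinals $\alpha$, and $P(\cdot)$ denotes the prime radical.
   Context: All rings are associative with identity; ''ideal'' means two-sided ideal. A derivation of $R$ is an additive map $\delta:R\to R$ with $\delta(ab)=\delta(a)b+a\delta(b)$ for all $a,b\in R$. The pseudo-differential operator ring $R((x^{-1};\delta))$ consists of the formal series $\sum_{i=-\infty}^{n}a_{i}x^{i}$ with $n$ an integer (possibly negative) and $a_i\in R$, with the usual addition and with multiplication determined by $xa=ax+\delta(a)$ and $x^{-1}a=\sum_{i=0}^{\infty}(-1)^{i}\delta^{i}(a)x^{-i-1}$ for all $a\in R$ (equivalently $x^{m}a=\sum_{k\ge 0}\binom{m}{k}\delta^{k}(a)x^{m-k}$ for every integer $m$). For a subset $I\subseteq R$, $I((x^{-1};\delta))$ denotes the subset of $R((x^{-1};\delta))$ of series whose coefficients all lie in $I$. A subset $S$ of a ring is left T-nilpotent if for every countable sequence $s_1,s_2,\ldots\in S$ there is an integer $k\geq 1$ with $s_1s_2\cdots s_k=0$. For a ring $A$ with derivation $d$, put $\mathcal{I}_{l,d}(A)=\{a \in A : \sum_{j=0}^{\infty}d^{j}(a)A \text{ is left T-nilpotent}\}$, where $\sum_{j=0}^{\infty}d^{j}(a)A$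 is the sum of the right ideals $d^j(a)A$ (finite sums of elements). The ideals $\mathcal{I}_{l,\delta}^{(\alpha)}(R)$ are defined by transfinite recursion: $\mathcal{I}_{l,\delta}^{(0)}(R)=0$; if $\alpha$ is the successor of $\beta$, then $\mathcal{I}_{l,\delta}^{(\alpha)}(R)=\{a\in R: a+\mathcal{I}_{l,\delta}^{(\beta)}(R)\in\mathcal{I}_{l,\bar\delta}(R/\mathcal{I}_{l,\delta}^{(\beta)}(R))\}$, where $\bar\delta$ is the derivation of $R/\mathcal{I}_{l,\delta}^{(\beta)}(R)$ induced by $\delta$; if $\alpha$ is a limit ordinal, then $\mathcal{I}_{l,\delta}^{(\alpha)}(R)=\bigcup_{\beta<\alpha}\mathcal{I}_{l,\delta}^{(\beta)}(R)$. These are ideals of $R$ stable under $\delta$, increasing with $\alpha$. *)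

(* Defs.v *)
From HB Require Import structures.
From mathcomp Require Import all_boot all_order all_algebra.
From mathcomp Require Import zify ring.
From mathcomp Require Import all_classical.

Set Implicit Arguments.
Unset Strict Implicit.
Unset Printing Implicit Defensive.

Import Order.TTheory GRing.Theory Num.Theory.
Local Open Scope classical_set_scope.
Local Open Scope ring_scope.

(* Generalized binomial coefficient binom(m, k) for an integer m; recall that
   binom(-(n+1), k) = (-1)^k binom(n+k, k). See binz_ffact and binzS. *)
Definition binz (m : int) (k : nat) : int :=
  match m with
  | Posz n => 'C(n, k)%:Z
  | Negz n => (-1) ^+ k * 'C(n + k, k)%:Z
  end.

Lemma binz0 m : binz m 0 = 1.
Proof. by case: m => n; rewrite /binz ?expr0 ?mul1r bin0. Qed.

Lemma binz_rec m k : k.+1%:Z * binz m k.+1 = (m - k%:Z) * binz m k.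
Proof.
case: m => n /=.
  rewrite -PoszM mul_bin_left PoszM.
  have [le_kn|lt_nk] := leqP k n; first by rewrite subzn.
  by rewrite bin_small // mulr0 mulr0.
rewrite mulrCA -PoszM.
have -> : (k.+1 * 'C(n + k.+1, k.+1) = (n + k.+1) * 'C(n + k, k))%N.
  by rewrite -mul_bin_diag addnS.
rewrite NegzE exprS PoszM PoszD mulrA.
by rewrite [RHS]mulrA [X in _ = X * _]mulrC; congr (_ * _); ring.
Qed.

Lemma binz_ffact m k : k`!%:Z * binz m k = \prod_(t < k) (m - t%:Z).
Proof.
elim: k => [|k IH]; first by rewrite binz0 big_ord0.
rewrite big_ord_recr /= -IH factS PoszM [_%:Z * k`!%:Z]mulrC -mulrA.
by rewrite -[LHS]mulrA (binz_rec m k) [(m - _) * _]mulrC.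
Qed.

Lemma binzS m k : binz (m + 1) k.+1 = binz m k.+1 + binz m k.
Proof.
case: m => [n|[|n]].
- by rewrite -PoszD addn1 /= binS PoszD.
- by rewrite /= !add0n !binn exprS !mulr1 mulN1r addNr.
have -> : Negz n.+1 + 1 = Negz n by rewrite !NegzE; lia.
by rewrite /= exprS !addSn !addnS [in RHS]binS PoszD; ring.
Qed.

Lemma binz_Vandermonde (m n : int) (k : nat) :
  binz (m + n) k = \sum_(s < k.+1) binz m s * binz n (k - s)%N.
Proof.
pose V m k := \sum_(s < k.+1) binz m s * binz n (k - s)%N.
rewrite -/(V m k).
have V0 m' : V m' 0 = 1 by rewrite /V big_ord1 !binz0 mulr1.
have VS m' k' : V (m' + 1) k'.+1 = V m' k'.+1 + V m' k'.
  rewrite /V big_ord_recl [in RHS]big_ord_recl !binz0 -addrA; congr (_ + _).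
  rewrite -big_split /=; apply: eq_bigr => s _.
  by rewrite /bump /= add1n subSS binzS mulrDl.
elim/int_ind: m k => [|m IH|m IH] k.
- rewrite add0r /V big_ord_recl big1 ?addr0; last first.
    by move=> i _; rewrite /= bin0n mul0r.
  by rewrite binz0 subn0 mul1r.
- case: k => [|k]; first by rewrite V0 binz0.
  by rewrite -addn1 PoszD addrAC binzS VS !IH.
- elim: k => [|k IHk]; first by rewrite V0 binz0.
  have em : - m.+1%:Z + 1 = - m%:Z by lia.
  have := VS (- m.+1%:Z) k; rewrite em -IH -IHk.
  have -> : - m%:Z + n = - m.+1%:Z + n + 1 by lia.
  by rewrite binzS => /addIr.
Qed.

Lemma binz_trinomial (m : int) (k s : nat) :
  binz m (k + s)%N * 'C(k + s, k)%:Z = binz m k * binz (m - k%:Z) s.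
Proof.
have nz : (k`! * s`!)%:Z != 0 by have := fact_gt0 k; have := fact_gt0 s; lia.
apply: (mulfI nz).
transitivity (\prod_(t < k + s) (m - t%:Z)).
  rewrite -binz_ffact -(bin_fact (leq_addr s k)) addKn !PoszM; ring.
rewrite big_split_ord /= -binz_ffact PoszM.
under eq_bigr do rewrite PoszD opprD addrA.
by rewrite -binz_ffact; ring.
Qed.

Record derivation (A : pzRingType) := Derivation {
  der :> A -> A;
  derD : forall a b, der (a + b) = der a + der b;
  derM : forall a b, der (a * b) = der a * b + a * der b
}.

Section DerivationTheory.
Variables (A : pzRingType) (d : derivation A).

Lemma der_is_zmod_morphism : zmod_morphism d.
Proof.
have d0 : d 0 = 0 by apply: (addrI (d 0)); rewrite -derD !addr0.
have dN a : d (- a) = - d a by apply: (addrI (d a)); rewrite -derD !subrr.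
by move=> a b; rewrite derD dN.
Qed.
HB.instance Definition _ := GRing.isZmodMorphism.Build A A d der_is_zmod_morphism.

Lemma iter_der_is_zmod_morphism n : zmod_morphism (iter n d).
Proof. by elim: n => [//|n IH] a b /=; rewrite IH raddfB. Qed.
HB.instance Definition _ n :=
  GRing.isZmodMorphism.Build A A (iter n d) (iter_der_is_zmod_morphism n).

Lemma der1 : d 1 = 0.
Proof. by apply: (addrI (d 1)); rewrite addr0 -{3}(mulr1 1) derM mul1r mulr1. Qed.

Lemma iter_der1 n : iter n.+1 d 1 = 0.
Proof. by elim: n => [|n IH]; [exact: der1 | rewrite iterS IH raddf0]. Qed.

Lemma iter_derM n a b : iter n d (a * b) =
  \sum_(r < n.+1) (iter r d a * iter (n - r) d b) *+ 'C(n, r).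
Proof.
elim: n a b => [|n IH] a b; first by rewrite big_ord1.
rewrite iterSr derM raddfD /= !IH [RHS]big_ord_recl.
under [in RHS]eq_bigr do rewrite lift0 subSS binS mulrnDr.
rewrite big_split /= [X in _ = _ + (X + _)]big_ord_recr /= (@bin_small n n.+1) //.
rewrite mulr0n addr0 addrA [RHS]addrC; congr (_ + _).
  by apply: eq_bigr => r _; rewrite -iterSr.
rewrite big_ord_recl /= !bin0 !subn0 -iterSr; congr (_ + _).
by apply: eq_bigr => r _; rewrite /bump leq0n add1n -iterSr -iterS subnSK.
Qed.
End DerivationTheory.
Section Convolution.
Variables (A : pzRingType) (d : derivation A).
Implicit Types (a b c : nat -> A) (m n : int).

(* Coefficient of x^(m+n-t) in (sum_i a_i x^(m-i)) (sum_j b_j x^(n-j)); any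
   T > t gives the same value. *)
Definition conv (T : nat) (m : int) a b (t : nat) : A :=
  \sum_(i < T) \sum_(j < T) \sum_(k < T)
    (a i * iter k d (b j) *~ binz (m - i%:Z) k) *+ (i + k + j == t)%N.

Let exch2 (T : nat) (F : 'I_T -> 'I_T -> 'I_T -> A) :
  \sum_u \sum_v \sum_w F u v w = \sum_v \sum_w \sum_u F u v w.
Proof. by rewrite exchange_big; apply: eq_bigr => v _; rewrite exchange_big. Qed.

Let exch4 (T : nat) (F : 'I_T -> 'I_T -> 'I_T -> 'I_T -> 'I_T -> A) :
  \sum_u \sum_v \sum_w \sum_x \sum_y F u v w x y =
  \sum_v \sum_w \sum_x \sum_y \sum_u F u v w x y.
Proof.
rewrite exch2; apply: eq_bigr => v _; apply: eq_bigr => w _.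
by rewrite exch2.
Qed.

Lemma conv_collapse (T : nat) m a b (g : nat -> A -> A) :
  (forall s, {morph g s : x y / x + y}) -> (forall s, g s 0 = 0) ->
  \sum_(s < T) g s (conv T m a b s) =
  \sum_(i < T) \sum_(j < T) \sum_(k < T)
    if (i + k + j < T)%N
    then g (i + k + j)%N (a i * iter k d (b j) *~ binz (m - i%:Z) k) else 0.
Proof.
move=> gD g0; pose gS s := big_morph (g s) (gD s) (g0 s).
under eq_bigr do rewrite gS; rewrite exchange_big; apply: eq_bigr => i _ /=.
under eq_bigr do rewrite gS; rewrite exchange_big; apply: eq_bigr => j _ /=.
under eq_bigr do rewrite gS; rewrite exchange_big; apply: eq_bigr => k _ /=.
case: ifPn => [lt_T|nlt_T].
  rewrite (bigD1 (Ordinal lt_T)) //= eqxx mulr1n big1 ?addr0 // => s ne_s.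
  by rewrite eq_sym -(inj_eq val_inj) /= in ne_s; rewrite (negPf ne_s) mulr0n g0.
rewrite big1 // => s _; case: eqP => [e|]; last by rewrite mulr0n g0.
by rewrite e ltn_ord in nlt_T.
Qed.

Let diag (T n : nat) (F : nat -> nat -> A) : (n < T)%N ->
  \sum_(p < T) \sum_(q < T) F p q *+ (p + q == n)%N =
  \sum_(p < n.+1) F p (n - p)%N.
Proof.
move=> lt_nT; rewrite (big_ord_widen T (fun p => F p (n - p)%N)) // [RHS]big_mkcond.
apply: eq_bigr => p _; case: ifPn => [le_pn|]; last first.
  rewrite -leqNgt => lt_np; apply: big1 => q _.
  by rewrite (_ : _ == _ = false) ?mulr0n //; apply/negbTE; lia.
have lt_T : (n - p < T)%N by lia.
rewrite (bigD1 (Ordinal lt_T)) //= big1 ?addr0 => [|q ne_q].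
  by rewrite (_ : _ == _ = true) ?mulr1n //; lia.
rewrite -(inj_eq val_inj) /= in ne_q.
by rewrite (_ : _ == _ = false) ?mulr0n //; apply/negbTE; lia.
Qed.

Let twist (T n : nat) (x y : int) (b c : A) : (n < T)%N ->
  \sum_(p < T) \sum_(q < T)
     (iter p d (b * iter q d c) *~ (binz x p * binz y q)) *+ (p + q == n)%N =
  \sum_(u < T) \sum_(v < T)
     (iter u d b * iter v d c *~ (binz x u * binz (x - u%:Z + y) v))
       *+ (u + v == n)%N.
Proof.
move=> lt_nT.
rewrite (diag (fun p q => iter p d (b * iter q d c) *~ (binz x p * binz y q))) //.
rewrite (diag (fun u v => iter u d b * iter v d c *~
  (binz x u * binz (x - u%:Z + y) v))) //.
pose F p r := iter r d b * iter (n - r) d c *~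
  (binz x p * 'C(p, r)%:Z * binz y (n - p)%N).
transitivity (\sum_(p < n.+1) \sum_(r < n.+1 | (r < p.+1)%N) F p r).
  apply: eq_bigr => p _; rewrite -(big_ord_widen n.+1 (F p)) ?ltn_ord //.
  have zsum (k : nat) (G : 'I_k -> A) (z : int) :
    (\sum_i G i) *~ z = \sum_i (G i *~ z).
    by apply: (big_morph (fun w => w *~ z)) => [w w'|]; rewrite ?mulrzDl ?mul0rz.
  rewrite iter_derM zsum; apply: eq_bigr => r _; rewrite /F -iterD.
  have -> : (p - r + (n - p) = n - r)%N.
    by have := ltn_ord r; have := ltn_ord p; lia.
  by rewrite pmulrn -mulrzA; congr (_ *~ _); ring.
rewrite (exchange_big_dep predT) //=; apply: eq_bigr => r _.
have le_rn : (r <= n)%N by have := ltn_ord r; lia.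
have zsum (k : nat) (P : pred 'I_k) (G : 'I_k -> int) (z : A) :
  z *~ (\sum_(i | P i) G i) = \sum_(i | P i) (z *~ G i).
  by apply: (big_morph (fun w => z *~ w)) => [w w'|]; rewrite ?mulrzDr ?mulr0z.
rewrite /F -zsum; congr (_ *~ _).
rewrite binz_Vandermonde big_distrr /=.
rewrite (big_ord_widen_cond n.+1 xpredT
  (fun i => binz x r * (binz (x - r%:Z) i * binz y (n - r - i)%N))); last by lia.
rewrite [RHS](eq_bigl (fun i : 'I_n.+1 => (i < (n - r).+1)%N)) //.
rewrite -(big_mkord (fun i => (r < i.+1)%N)
  (fun i => binz x i * 'C(i, r)%:Z * binz y (n - i)%N)).
rewrite -(big_mkord (fun i => (i < (n - r).+1)%N)
  (fun i => binz x r * (binz (x - r%:Z) i * binz y (n - r - i)%N))).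
rewrite -(big_nat_widen 0 (n - r).+1 n.+1 xpredT) ?ltnS ?leq_subr //=.
rewrite (@big_cat_nat _ _ _ r) //=; last by lia.
rewrite big1_seq ?add0r => [|i /andP[lt_ri]]; last first.
  by rewrite mem_index_iota; lia.
rewrite big_nat_cond (eq_bigl (fun i => (r <= i < n.+1)%N)); last first.
  by move=> i; rewrite ltnS; lia.
rewrite -big_nat -{1}[X in index_iota X _](add0n r) big_addn subSn //.
apply: eq_bigr => i _; rewrite addnC binz_trinomial mulrA; congr (_ * binz _ _).
by rewrite subnDA.
Qed.

Lemma convA (T : nat) m n a b c (t : nat) : (t < T)%N ->
  conv T (m + n) (conv T m a b) c t = conv T m a (conv T n b c) t.
Proof.
move=> lt_tT.
pose G (i j l u v : nat) (z : A) := z *+ (i + j + l + (u + v) == t)%N.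
transitivity (\sum_(i < T) \sum_(j < T) \sum_(l < T) \sum_(u < T) \sum_(v < T)
  G i j l u v (a i * (iter u d (b j) * iter v d (c l) *~
    (binz (m - i%:Z) u * binz (m - i%:Z - u%:Z + (n - j%:Z)) v)))).
  transitivity (\sum_(k' < T) \sum_(l < T) \sum_(i < T) \sum_(j < T) \sum_(u < T)
    G i j l u k' (a i * (iter u d (b j) * iter k' d (c l) *~
    (binz (m - i%:Z) u * binz (m - i%:Z - u%:Z + (n - j%:Z)) k')))).
    rewrite {1}/conv exch2.
    rewrite [RHS]exchange_big /=; apply: eq_bigr => l _.
    apply: eq_bigr => k' _.
    apply: (etrans (@conv_collapse T _ _ _ (fun s z =>
      (z * iter k' d (c l) *~ binz (m + n - s%:Z) k') *+ (s + k' + l == t)%N) _ _) _).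
    - by move=> s z z'; rewrite mulrDl mulrzDl mulrnDl.
    - by move=> s; rewrite mul0r mul0rz mul0rn.
    - apply: eq_bigr => i _; apply: eq_bigr => j _; apply: eq_bigr => u _.
      rewrite /G (_ : (i + u + j + k' + l)%N = (i + j + l + (u + k'))%N); last by lia.
      case: ifPn => [_|]; last first.
        rewrite -leqNgt => leT; rewrite (_ : _ == _ = false) //.
        by apply/negbTE; lia.
      congr (_ *+ _); rewrite !PoszD.
      have -> : m + n - (i%:Z + u%:Z + j%:Z) = m - i%:Z - u%:Z + (n - j%:Z) by ring.
      by rewrite mulrzAl -mulrzA mulrzAr -mulrA.
  rewrite exch4 exch2.
  by [].
rewrite {1}/conv; apply: eq_bigr => i _.
transitivity (\sum_(p < T) \sum_(j < T) \sum_(l < T) \sum_(q < T)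
  G i j l p q (a i * (iter p d (b j * iter q d (c l)) *~
    (binz (m - i%:Z) p * binz (n - j%:Z) q)))); last first.
  rewrite [RHS]exchange_big; apply: eq_bigr => p _; apply/esym => /=.
  apply: (etrans (@conv_collapse T _ _ _ (fun s z =>
    (a i * iter p d z *~ binz (m - i%:Z) p) *+ (i + p + s == t)%N) _ _) _).
  - by move=> s z z'; rewrite raddfD mulrDr mulrzDl mulrnDl.
  - by move=> s; rewrite raddf0 mulr0 mul0rz mul0rn.
  - apply: eq_bigr => j _; apply: eq_bigr => l _; apply: eq_bigr => q _.
    rewrite /G (_ : (i + p + (j + q + l))%N = (i + j + l + (p + q))%N); last by lia.
    case: ifPn => [_|]; last first.
      rewrite -leqNgt => leT; rewrite (_ : _ == _ = false) //.
      by apply/negbTE; lia.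
    by rewrite raddfMz -mulrzAr -mulrzA [X in _ *~ X]mulrC.
rewrite [RHS]exch2; apply: eq_bigr => j _; apply: eq_bigr => l _.
have [le_t|lt_t] := leqP (i + j + l) t; last first.
  by rewrite !big1 // => p _; rewrite big1 // => q _;
     rewrite /G (_ : _ == _ = false) //; apply/negbTE; lia.
have Gn u v z : G i j l u v (a i * z) = a i * (z *+ (u + v == t - (i + j + l))%N).
  by rewrite /G -mulrnAr; congr (_ * (_ *+ nat_of_bool _)); lia.
under eq_bigr do under eq_bigr do rewrite Gn.
under [RHS]eq_bigr do under eq_bigr do rewrite Gn.
under eq_bigr do rewrite -mulr_sumr.
under [RHS]eq_bigr do rewrite -mulr_sumr.
rewrite -!mulr_sumr; congr (_ * _); rewrite twist //; lia.
Qed.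

End Convolution.

(* R((x^-1; d)): the series sum_i a_i x^i with a_i = pcoef f i, coefficients
   being written on the left of the powers of x. *)
Record pdo (A : pzRingType) (d : derivation A) := PDO {
  pcoef : int -> A;
  pcoef_bounded : exists n : int, forall i, n < i -> pcoef i = 0
}.

HB.instance Definition _ (A : pzRingType) (d : derivation A) :=
  gen_eqMixin (pdo d).
HB.instance Definition _ (A : pzRingType) (d : derivation A) :=
  gen_choiceMixin (pdo d).

Section PseudoDifferentialOperators.
Variables (A : pzRingType) (d : derivation A).
Implicit Types (f g h : pdo d) (m n : int).

Lemma pdoP f g : (forall i, pcoef f i = pcoef g i) -> f = g.
Proof.
case: f g => [f Bf] [g Bg] /= /funext efg; case: _ / efg in Bg *.
by congr PDO; exact: Prop_irrelevance.
Qed.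

Definition pbound f n := forall i, n < i -> pcoef f i = 0.

Definition pdo_zero : pdo d := @PDO A d (fun=> 0) (ex_intro _ 0 (fun _ _ => erefl)).

Lemma pdo_opp_bounded f : exists n, forall i, n < i -> - pcoef f i = 0.
Proof.
by have [n fn] := pcoef_bounded f; exists n => i /fn ->; rewrite oppr0.
Qed.
Definition pdo_opp f : pdo d := PDO d (pdo_opp_bounded f).

Lemma pdo_add_bounded f g :
  exists n, forall i, n < i -> pcoef f i + pcoef g i = 0.
Proof.
have [[n fn] [m gm]] := (pcoef_bounded f, pcoef_bounded g).
by exists (Num.max n m) => i; rewrite gt_max => /andP[/fn-> /gm->]; rewrite addr0.
Qed.
Definition pdo_add f g : pdo d := PDO d (pdo_add_bounded f g).

Definition pdo_one_coef (i : int) : A := (i == 0)%:R.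
Lemma pdo_one_bounded : exists n, forall i, n < i -> pdo_one_coef i = 0.
Proof. by exists 0 => i i0; rewrite /pdo_one_coef gt_eqF. Qed.
Definition pdo_one : pdo d := PDO d pdo_one_bounded.

(* From x^i b = sum_k binom(i, k) d^k(b) x^(i-k), the coefficient of x^n in
   (sum_i a_i x^i) (sum_j b_j x^j) is the sum over i, k, with j = n + k - i, of
   binom(i, k) a_i d^k(b_j); it has finite support (see pdo_mul_conv). *)
Definition pdo_mul_coef f g n : A :=
  \sum_(p \in [set: int * nat])
    (pcoef f p.1 * iter p.2 d (pcoef g (n + p.2%:Z - p.1))) *~ binz p.1 p.2.

Lemma pdo_mul_conv f g m n (T t : nat) :
  pbound f m -> pbound g n -> (t < T)%N ->
  pdo_mul_coef f g (m + n - t%:Z) =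
  conv d T m (fun i : nat => pcoef f (m - i%:Z)) (fun j => pcoef g (n - j%:Z)) t.
Proof.
move=> fm gn lt_tT; rewrite /pdo_mul_coef /conv.
pose r := [seq (m - i%:Z, k) | i <- iota 0 T, k <- iota 0 T].
have gz (i k : nat) : (t < i + k)%N ->
    pcoef g (m + n - t%:Z + k%:Z - (m - i%:Z)) = 0.
  by move=> lt_t; apply: gn; lia.
rewrite (fsbigE r) //; last 2 first.
- apply: allpairs_uniq; rewrite ?iota_uniq //.
  by move=> [i k] [i' k'] _ _ /= [+ ->]; move=> /addrI/oppr_inj[->].
- move=> [i k] _ /=; have [le_im|/fm ->] := leP i m; last by rewrite mul0r mul0rz.
  move=> nr; have -> : i = m - `|m - i|%N%:Z by lia.
  have [|lt_t] := leqP (`|m - i| + k) t.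
    move=> le_t; case/negP: nr; apply/allpairsP; exists (`|m - i|%N, k) => /=.
    by rewrite !mem_iota; split; [lia|lia|congr (_, _); lia].
  by rewrite gz // raddf0 mulr0 mul0rz.
rewrite (eq_bigl xpredT) => [|p]; last by rewrite in_setT.
rewrite /r big_allpairs_dep /= -{1}(subn0 T) big_mkord; apply: eq_bigr => i _.
rewrite exchange_big -{1}(subn0 T) big_mkord; apply: eq_bigr => k _ /=.
have [le_t|lt_t] := leqP (i + k) t; last first.
  rewrite gz // raddf0 mulr0 mul0rz big1 // => j _.
  by rewrite (_ : _ == _ = false) //; apply/negbTE; lia.
have lt_T : (t - (i + k) < T)%N by lia.
rewrite (bigD1 (Ordinal lt_T)) //= big1 ?addr0 => [|j ne_j].
  rewrite (_ : _ == _ = true) ?mulr1n; last lia.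
  by congr (_ * iter _ _ (pcoef g _) *~ _); lia.
rewrite -(inj_eq val_inj) /= in ne_j.
by rewrite (_ : _ == _ = false) ?mulr0n //; apply/negbTE; lia.
Qed.

Lemma pdo_mul_pbound f g m n : pbound f m -> pbound g n ->
  forall i, m + n < i -> pdo_mul_coef f g i = 0.
Proof.
move=> fm gn i lt_i; apply: fsbig1 => -[j k] _ /=.
have [le_jm|/fm ->] := leP j m; last by rewrite mul0r mul0rz.
by rewrite gn ?raddf0 ?mulr0 ?mul0rz //; lia.
Qed.

Lemma pdo_mul_bounded f g : exists n, forall i, n < i -> pdo_mul_coef f g i = 0.
Proof.
have [[m fm] [n gn]] := (pcoef_bounded f, pcoef_bounded g).
by exists (m + n); exact: pdo_mul_pbound.
Qed.
Definition pdo_mul f g : pdo d := PDO d (pdo_mul_bounded f g).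

Lemma pdo_addA : associative pdo_add.
Proof. by move=> f g h; apply: pdoP => i /=; rewrite addrA. Qed.

Lemma pdo_addC : commutative pdo_add.
Proof. by move=> f g; apply: pdoP => i /=; rewrite addrC. Qed.

Lemma pdo_add0 : left_id pdo_zero pdo_add.
Proof. by move=> f; apply: pdoP => i /=; rewrite add0r. Qed.

Lemma pdo_addN : left_inverse pdo_zero pdo_opp pdo_add.
Proof. by move=> f; apply: pdoP => i /=; rewrite addNr. Qed.

HB.instance Definition _ :=
  GRing.isZmodule.Build (pdo d) pdo_addA pdo_addC pdo_add0 pdo_addN.

Lemma pcoefD f g i : pcoef (f + g) i = pcoef f i + pcoef g i.
Proof. by []. Qed.

Lemma pboundW f m n : m <= n -> pbound f m -> pbound f n.
Proof. by move=> le_mn fm i /(le_lt_trans le_mn); exact: fm. Qed.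

Lemma pboundD f g m : pbound f m -> pbound g m -> pbound (f + g) m.
Proof. by move=> fm gm i lt_i; rewrite pcoefD fm // gm // addr0. Qed.

Lemma pbound_mul f g m n :
  pbound f m -> pbound g n -> pbound (pdo_mul f g) (m + n).
Proof. by move=> fm gn i; exact: pdo_mul_pbound. Qed.

Lemma eq_conv T m (a a' b b' : nat -> A) t :
  (forall i, (i < T)%N -> a i = a' i) -> (forall i, (i < T)%N -> b i = b' i) ->
  conv d T m a b t = conv d T m a' b' t.
Proof.
move=> ea eb; apply: eq_bigr => i _; apply: eq_bigr => j _.
by apply: eq_bigr => k _; rewrite ea // eb.
Qed.

Lemma pdo_eqP f g m : pbound f m -> pbound g m ->
  (forall t : nat, pcoef f (m - t%:Z) = pcoef g (m - t%:Z)) -> f = g.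
Proof.
move=> fm gm efg; apply: pdoP => i; have [le_im|lt_mi] := leP i m.
  by have -> : i = m - `|m - i|%N%:Z by lia.
by rewrite fm // gm.
Qed.

Lemma pdo_mulA : associative pdo_mul.
Proof.
move=> f g h; have [m fm] := pcoef_bounded f.
have [[n gn] [l hl]] := (pcoef_bounded g, pcoef_bounded h).
apply: (@pdo_eqP _ _ (m + n + l)) => [||t].
- by rewrite -addrA; do 2?apply: pbound_mul.
- by do 2?apply: pbound_mul.
have e1 := pdo_mul_conv (pbound_mul fm gn) hl (ltnSn t).
have e2 := pdo_mul_conv fm (pbound_mul gn hl) (ltnSn t).
rewrite (addrA m n l) in e2.
rewrite -[LHS]/(pdo_mul_coef f (pdo_mul g h) _).
rewrite -[RHS]/(pdo_mul_coef (pdo_mul f g) h _) {}e1 {}e2.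
transitivity (conv d t.+1 m (fun i : nat => pcoef f (m - i%:Z))
  (conv d t.+1 n (fun i : nat => pcoef g (n - i%:Z))
                 (fun i : nat => pcoef h (l - i%:Z))) t).
  by apply: eq_conv => // i lt_i; exact: pdo_mul_conv.
rewrite -convA //; apply: eq_conv => // i lt_i.
by apply/esym; exact: pdo_mul_conv.
Qed.

Lemma pbound1 : pbound pdo_one 0.
Proof. by move=> i i0; rewrite /= /pdo_one_coef gt_eqF. Qed.

Lemma pdo_mul1l : left_id pdo_one pdo_mul.
Proof.
move=> f; have [m fm] := pcoef_bounded f.
apply: (@pdo_eqP _ _ m) => // [|t].
  by rewrite -[m]add0r; apply: pbound_mul => //; exact: pbound1.
rewrite -{1}[m]add0r [LHS](@pdo_mul_conv _ _ _ _ t.+1) //; last exact: pbound1.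
have z (i j k : nat) : (i != 0) || (j != t) || (k != 0) ->
    (pdo_one_coef (0 - i%:Z) * iter k d (pcoef f (m - j%:Z)) *~ binz (0 - i%:Z) k)
      *+ (i + k + j == t)%N = 0.
  rewrite /pdo_one_coef sub0r oppr_eq0.
  case: i => [|i]; last by rewrite mul0r mul0rz mul0rn.
  case: k => [|k]; last by rewrite oppr0 /= mulr0z mul0rn.
  by rewrite !eqxx !orbF !add0n => /negPf ->.
rewrite /conv big_ord_recl [X in _ + X = _]big1 => [|i _].
  rewrite addr0 (bigD1 ord_max) // [X in _ + X = _]big1 => [|j ne_j].
    rewrite addr0 big_ord_recl [X in _ + X = _]big1 => [|k _].
      rewrite addr0 -[nat_of_ord ord0]/0%N -[nat_of_ord ord_max]/t.
      by rewrite subrr eqxx binz0 mulr1z /= /pdo_one_coef eqxx mul1r.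
    by apply: z; rewrite orbT.
  apply: big1 => k _; apply: z.
  by rewrite -(inj_eq val_inj) /= in ne_j; rewrite ne_j.
by rewrite big1 // => j _; rewrite big1 // => k _; exact: z.
Qed.

Lemma pdo_mul1r : right_id pdo_one pdo_mul.
Proof.
move=> f; have [m fm] := pcoef_bounded f.
apply: (@pdo_eqP _ _ m) => // [|t].
  by rewrite -[m]addr0; apply: pbound_mul => //; exact: pbound1.
rewrite -{1}[m]addr0 [LHS](@pdo_mul_conv _ _ _ _ t.+1) //; last exact: pbound1.
have z (i j k : nat) : (i != t) || (j != 0) || (k != 0) ->
    (pcoef f (m - i%:Z) * iter k d (pdo_one_coef (0 - j%:Z)) *~ binz (m - i%:Z) k)
      *+ (i + k + j == t)%N = 0.
  rewrite /pdo_one_coef sub0r oppr_eq0.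
  case: j => [|j]; last by rewrite raddf0 mulr0 mul0rz mul0rn.
  case: k => [|k]; last by rewrite eqxx iter_der1 mulr0 mul0rz mul0rn.
  by rewrite !eqxx !orbF !addn0 => /negPf ->.
rewrite /conv (bigD1 ord_max) //= [X in _ + X = _]big1 => [|i ne_i].
  rewrite addr0 big_ord_recl [X in _ + X = _]big1 => [|j _].
    rewrite addr0 big_ord_recl [X in _ + X = _]big1 => [|k _].
      rewrite addr0 /= /pdo_one_coef subr0 eqxx mulr1 binz0 mulr1z !addn0 eqxx.
      by [].
    by rewrite z // orbT.
  by apply: big1 => k _; rewrite z // orbT.
rewrite big1 // => j _; rewrite big1 // => k _; rewrite z //.
by rewrite -(inj_eq val_inj) /= in ne_i; rewrite ne_i.
Qed.

Lemma pdo_mulDl : left_distributive pdo_mul +%R.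
Proof.
move=> f f' g; have [m0 fm0] := pcoef_bounded f.
have [[m1 fm1] [n gn]] := (pcoef_bounded f', pcoef_bounded g).
pose m := Num.max m0 m1.
have fm : pbound f m by apply: pboundW fm0; rewrite le_max lexx.
have fm' : pbound f' m by apply: pboundW fm1; rewrite le_max lexx orbT.
apply: (@pdo_eqP _ _ (m + n)) => [||t].
- by apply: pbound_mul => //; exact: pboundD.
- by apply: pboundD; exact: pbound_mul.
rewrite pcoefD /= !(@pdo_mul_conv _ _ _ _ t.+1) //; last exact: pboundD.
rewrite -big_split; apply: eq_bigr => i _; rewrite -big_split.
apply: eq_bigr => j _; rewrite -big_split; apply: eq_bigr => k _ /=.
by rewrite mulrDl mulrzDl mulrnDl.
Qed.

Lemma pdo_mulDr : right_distributive pdo_mul +%R.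
Proof.
move=> g f f'; have [m0 fm0] := pcoef_bounded f.
have [[m1 fm1] [n gn]] := (pcoef_bounded f', pcoef_bounded g).
pose m := Num.max m0 m1.
have fm : pbound f m by apply: pboundW fm0; rewrite le_max lexx.
have fm' : pbound f' m by apply: pboundW fm1; rewrite le_max lexx orbT.
apply: (@pdo_eqP _ _ (n + m)) => [||t].
- by apply: pbound_mul => //; exact: pboundD.
- by apply: pboundD; exact: pbound_mul.
rewrite pcoefD /= !(@pdo_mul_conv _ _ _ _ t.+1) //; last exact: pboundD.
rewrite -big_split; apply: eq_bigr => i _; rewrite -big_split.
apply: eq_bigr => j _; rewrite -big_split; apply: eq_bigr => k _ /=.
by rewrite raddfD mulrDr mulrzDl mulrnDl.
Qed.

HB.instance Definition _ := GRing.Zmodule_isPzRing.Build (pdo d)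
  pdo_mulA pdo_mul1l pdo_mul1r pdo_mulDl pdo_mulDr.

Lemma pcoefM f g n : pcoef (f * g) n = \sum_(p \in [set: int * nat])
  (pcoef f p.1 * iter p.2 d (pcoef g (n + p.2%:Z - p.1))) *~ binz p.1 p.2.
Proof. by []. Qed.

End PseudoDifferentialOperators.

Section PdoMonomials.
Variables (A : pzRingType) (d : derivation A).

Lemma pdo_const_bounded (a : A) :
  exists n : int, forall i, n < i -> a *+ (i == 0) = 0.
Proof. by exists 0 => i i0; rewrite gt_eqF. Qed.
Definition pdo_const (a : A) : pdo d := PDO d (pdo_const_bounded a).

Lemma pdo_monom_bounded (m : int) :
  exists n : int, forall i, n < i -> (i == m)%:R = 0 :> A.
Proof. by exists m => i lt_mi; rewrite gt_eqF. Qed.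
Definition pdo_monom (m : int) : pdo d := PDO d (pdo_monom_bounded m).

Lemma pdo_monom_const (m : int) (a : A) (k : nat) :
  pcoef (pdo_monom m * pdo_const a) (m - k%:Z) = iter k d a *~ binz m k.
Proof.
rewrite pcoefM (fsbigE [:: (m, k)]) //= => [|[i l] _]; last first.
  rewrite inE; have [->|] := eqVneq i m; last by rewrite mul0r mul0rz.
  rewrite xpair_eqE eqxx /= mul1r => ne_l.
  rewrite (_ : _ == 0 = false) ?raddf0 ?mul0rz //.
  by apply/negbTE; apply: contraNneq ne_l; lia.
rewrite big_cons big_nil in_setT /= eqxx mul1r addr0.
by rewrite (_ : _ == 0 = true) //; lia.
Qed.

End PdoMonomials.

Section Ideals.
Variable A : pzRingType.
Implicit Types (I J P S : set A).

Definition left_ideal I :=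
  [/\ I 0, forall a b, I a -> I b -> I (a + b) & forall r a, I a -> I (r * a)].

Definition right_ideal I :=
  [/\ I 0, forall a b, I a -> I b -> I (a + b) & forall r a, I a -> I (a * r)].

Definition two_sided_ideal I := left_ideal I /\ right_ideal I.

Definition left_noetherian :=
  forall I : nat -> set A, (forall n, left_ideal (I n)) ->
    (forall n, I n `<=` I n.+1) ->
  exists n, forall m, (n <= m)%N -> I m = I n.

Definition right_noetherian :=
  forall I : nat -> set A, (forall n, right_ideal (I n)) ->
    (forall n, I n `<=` I n.+1) ->
  exists n, forall m, (n <= m)%N -> I m = I n.

Definition prime_ideal P :=
  [/\ two_sided_ideal P, P <> setT &
    forall I J, two_sided_ideal I -> two_sided_ideal J ->
      (forall a b, I a -> J b -> P (a * b)) -> I `<=` P \/ J `<=` P].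

Definition prime_radical : set A := \bigcap_(P in [set P | prime_ideal P]) P.

Definition left_T_nilpotent S :=
  forall s : nat -> A, (forall i, S (s i)) ->
    exists2 k : nat, (0 < k)%N & \prod_(i < k) s i = 0.

End Ideals.

Arguments prime_radical : clear implicits.
Arguments left_noetherian : clear implicits.
Arguments right_noetherian : clear implicits.

Section Il.
Variables (A : pzRingType) (d : derivation A).

(* sum_j d^j(a) A *)
Definition der_right_ideal (a : A) : set A :=
  [set b | exists n (r : nat -> A), b = \sum_(j < n) iter j d a * r j].

Definition Il : set A := [set a | left_T_nilpotent (der_right_ideal a)].

End Il.

Section TNilpotence.
Variable A : pzRingType.
Implicit Types (S T X Y : set A).

Definition sums X : set A :=
  [set s | exists2 l : seq A, (forall x, x \in l -> X x) & s = \sum_(x <- l) x].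

Lemma sums0 X : sums X 0.
Proof. by exists [::]; rewrite ?big_nil. Qed.

Lemma sumsD X x y : sums X x -> sums X y -> sums X (x + y).
Proof.
move=> [l lX ->] [l' lX' ->]; exists (l ++ l'); last by rewrite big_cat.
by move=> z; rewrite mem_cat => /orP[/lX|/lX'].
Qed.

Lemma sums1 X x : X x -> sums X x.
Proof.
by move=> Xx; exists [:: x]; rewrite ?big_seq1 // => y; rewrite inE => /eqP->.
Qed.

Lemma sums_big X (n : nat) (F : 'I_n -> A) :
  (forall i, sums X (F i)) -> sums X (\sum_(i < n) F i).
Proof.
move=> XF; apply: (big_ind (sums X)) => [|x y|//]; first exact: sums0.
exact: sumsD.
Qed.

Lemma left_T_nilpotentS S T :
  S `<=` T -> left_T_nilpotent T -> left_T_nilpotent S.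
Proof. by move=> ST Tn s Ss; apply: Tn => i; exact: ST. Qed.

(* Koenig's lemma *)
Lemma left_T_nilpotent_sums X : left_T_nilpotent X -> left_T_nilpotent (sums X).
Proof.
move=> Xn s Ss; apply: contrapT => nz.
have ex_l i : exists li : seq A,
    (forall x, x \in li -> X x) /\ s i = \sum_(x <- li) x.
  by have [li liX ->] := Ss i; exists li.
have [l /all_and2[lX ls]] := choice ex_l.
pose bad n p := forall k, p * \prod_(i < k) s (n + i)%N <> 0.
have bad0 : bad 0%N 1.
  move=> k; rewrite mul1r => k0; apply: nz; exists k.+1 => //.
  rewrite big_ord_recr /= (_ : \prod_(i < k) s i = 0) ?mul0r //.
have badS n p : bad n p -> exists x, x \in l n /\ bad n.+1 (p * x).
  move=> bp; apply: contrapT => /forallNP nx.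
  have ex x : exists k, x \in l n ->
      p * x * \prod_(i < k) s (n.+1 + i)%N = 0.
    case: (boolP (x \in l n)) => [xl|_]; last by exists 0%N.
    have /not_andP[//|/existsNP[k /contrapT]] := nx x.
    by exists k.
  have [k kP] := choice ex; pose K := \max_(x <- l n) k x.
  apply: (bp K.+1); rewrite big_ord_recl addn0 ls mulrA mulr_sumr mulr_suml.
  rewrite big1_seq // => x /andP[_ xl].
  have le_k : (k x <= K)%N by rewrite /K (big_rem x) //= leq_maxl.
  rewrite -(subnKC le_k) big_split_ord /= mulrA.
  rewrite [X in X * _](_ : _ = 0) ?mul0r // -[RHS](kP _ xl).
  by congr (_ * _); apply: eq_bigr => i _; rewrite /bump leq0n add1n addnS.
pose next n p := xget 0 [set x | x \in l n /\ bad n.+1 (p * x)].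
have nextP n p : bad n p -> next n p \in l n /\ bad n.+1 (p * next n p).
  move=> /badS[x xP]; rewrite /next.
  by case: xgetP => [y -> //|/(_ x)] /(_ xP).
pose p := fix p n := if n is m.+1 then p m * next m (p m) else 1.
have bp n : bad n (p n) by elim: n => [|n /nextP[]].
have pE n : p n = \prod_(i < n) next i (p i).
  by elim: n => [|n IH]; rewrite ?big_ord0 // big_ord_recr /= -IH.
have [n|k _] := Xn (fun n => next n (p n)).
  by apply: (lX n); case: (nextP _ _ (bp n)).
by rewrite -pE => p0; apply: (bp k 0%N); rewrite p0 mul0r.
Qed.

Lemma left_T_nilpotent_mull T : (forall r a, T a -> T (a * r)) ->
  left_T_nilpotent T -> left_T_nilpotent [set r * t | r in setT & t in T].
Proof.
move=> Tr Tn s sT.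
have ex i : exists rt : A * A, T rt.2 /\ s i = rt.1 * rt.2.
  by have [r _ [t Tt <-]] := sT i; exists (r, t).
have [rt /all_and2[Trt sE]] := choice ex.
have [i|k k0 kP] := Tn (fun i => (rt i).2 * (rt i.+1).1); first exact: Tr.
exists k.+1 => //.
suff E n : \prod_(i < n.+1) s i =
    (rt 0).1 * \prod_(i < n) ((rt i).2 * (rt i.+1).1) * (rt n).2.
  by rewrite E kP mulr0 mul0r.
elim: n => [|n IH]; first by rewrite big_ord1 big_ord0 mulr1 sE.
by rewrite big_ord_recr /= IH big_ord_recr /= sE !mulrA.
Qed.

Lemma left_T_nilpotentU S T : (forall r a, T a -> T (a * r)) ->
  left_T_nilpotent S -> left_T_nilpotent T -> left_T_nilpotent (S `|` T).
Proof.
move=> Tr Sn Tn w wP.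
have split n k : \prod_(i < n + k) w i = \prod_(i < n) w i * \prod_(i < k) w (n + i)%N.
  by rewrite big_split_ord.
have [io|] := pselect (forall n, exists m, (n <= m)%N /\ T (w m)); last first.
  move=> /existsNP[n /forallNP nT].
  have [i|k k0 kP] := Sn (fun i => w (n + i)%N).
    have [//|Twi] := wP (n + i)%N.
    by case: (nT (n + i)%N); rewrite leq_addr.
  by exists (n + k)%N; [lia | rewrite split kP mulr0].
have [f /all_and2[fge fT]] := choice io.
pose e := fix e j := if j is j'.+1 then (f (e j')).+1 else 0%N.
pose G j := \prod_(i < e j.+1 - e j) w (e j + i)%N.
have [j|k k0 kP] := left_T_nilpotent_mull Tr Tn (s := G).
  rewrite /G (_ : e j.+1 - e j = (f (e j) - e j).+1)%N; last by rewrite /= subSn.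
  rewrite big_ord_recr /= subnKC //.
  by eexists; last by exists (w (f (e j))).
exists (e k); first by case: k k0 {kP}.
rewrite -kP; elim: k {k0 kP} => [|k IH]; first by rewrite !big_ord0.
have le_e : (e k <= e k.+1)%N by rewrite leqW.
by rewrite -(subnKC le_e) split IH [RHS]big_ord_recr.
Qed.

End TNilpotence.

Section IlIdeal.
Variables (A : pzRingType) (d : derivation A).
Local Notation T := (der_right_ideal d).

Lemma der_right_idealM a r b : T a b -> T a (b * r).
Proof.
move=> [n [s ->]]; exists n, (fun j => s j * r).
by rewrite mulr_suml; apply: eq_bigr => i _; rewrite mulrA.
Qed.

Lemma der_right_ideal0 a : T a 0.
Proof. by exists 0%N, (fun=> 0); rewrite big_ord0. Qed.

Lemma der_right_idealD a b c : T a b -> T a c -> T a (b + c).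
Proof.
move=> [n [s ->]] [m [t ->]].
have pad k (r : nat -> A) : (k <= n + m)%N -> \sum_(j < k) iter j d a * r j =
    \sum_(j < n + m) iter j d a * (if (j < k)%N then r j else 0).
  move=> le_k; rewrite (big_ord_widen _ (fun j => iter j d a * r j) le_k).
  rewrite big_mkcond; apply: eq_bigr => j _.
  by case: ifP => // _; rewrite mulr0.
rewrite (pad n) ?leq_addr // (pad m) ?leq_addl // -big_split.
eexists (n + m)%N, (fun j => (if (j < n)%N then s j else 0) +
  (if (j < m)%N then t j else 0)).
by apply: eq_bigr => j _; rewrite mulrDr.
Qed.

Lemma der_right_ideal_iter a j r : T a (iter j d a * r).
Proof.
exists j.+1, (fun i => if i == j then r else 0).
rewrite big_ord_recr /= eqxx big1 ?add0r // => i _.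
by rewrite ltn_eqF // mulr0.
Qed.

Lemma Il0 : Il d 0.
Proof.
move=> s sP; exists 1%N => //; rewrite big_ord1.
have [n [r ->]] := sP 0%N.
by apply: big1 => j _; rewrite raddf0 mul0r.
Qed.

Lemma IlD a b : Il d a -> Il d b -> Il d (a + b).
Proof.
move=> Ia Ib; apply: (@left_T_nilpotentS _ _ (sums (T a `|` T b))).
  move=> c [n [r ->]]; apply: sums_big => i.
  rewrite raddfD mulrDl; apply: sumsD; apply: sums1.
    by left; apply: der_right_ideal_iter.
  by right; exact: der_right_ideal_iter.
apply/left_T_nilpotent_sums/left_T_nilpotentU => // r c.
exact: der_right_idealM.
Qed.

Lemma IlMl r a : Il d a -> Il d (r * a).
Proof.
move=> Ia.
apply: (@left_T_nilpotentS _ _ (sums [set u * t | u in setT & t in T a])).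
  move=> c [n [s ->]]; apply: sums_big => i; rewrite iter_derM mulr_suml.
  apply: sums_big => k; apply: sums1; exists (iter k d r *+ 'C(i, k)) => //.
  exists (iter (i - k) d a * s i); first exact: der_right_ideal_iter.
  by rewrite mulrnAl mulrA mulrnAl mulrnAl.
apply/left_T_nilpotent_sums/left_T_nilpotent_mull => // u c.
exact: der_right_idealM.
Qed.

Lemma IlMr r a : Il d a -> Il d (a * r).
Proof.
apply: left_T_nilpotentS => c [n [s ->]].
have Tsum m (F : 'I_m -> A) : (forall i, T a (F i)) -> T a (\sum_i F i).
  move=> FT; apply: (big_ind (T a)) => [|x y|//]; first exact: der_right_ideal0.
  exact: der_right_idealD.
apply: (Tsum) => i; rewrite iter_derM mulr_suml; apply: (Tsum) => k.
by rewrite -mulrnAr -mulrA; exact: der_right_ideal_iter.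
Qed.

Lemma Il_der a : Il d a -> Il d (d a).
Proof.
apply: left_T_nilpotentS => c [n [s ->]].
apply: (big_ind (T a)) => [|x y|i _]; first exact: der_right_ideal0.
  exact: der_right_idealD.
by rewrite -iterSr; exact: der_right_ideal_iter.
Qed.

Lemma Il_two_sided : two_sided_ideal (Il d).
Proof.
by do 2?split; do ?[exact: Il0|exact: IlD|exact: IlMl|exact: IlMr].
Qed.

End IlIdeal.

Record der_ideal (A : pzRingType) (d : derivation A) := DerIdeal {
  der_ideal_set :> set A;
  der_ideal_two_sided : two_sided_ideal der_ideal_set;
  der_ideal_stable : forall a, der_ideal_set a -> der_ideal_set (d a)
}.

Section Quotient.
Local Open Scope quotient_scope.
Variables (A : pzRingType) (d : derivation A) (I : der_ideal d).

Definition der_ideal_pred : {pred A} := [pred a | `[< der_ideal_set I a >]].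

Lemma der_ideal_predP a : reflect (der_ideal_set I a) (a \in der_ideal_pred).
Proof. by rewrite inE; exact: asboolP. Qed.

Lemma der_ideal_zmod_closed : zmod_closed der_ideal_pred.
Proof.
have [[I0 ID IMl] _] := der_ideal_two_sided I.
split=> [|a b /der_ideal_predP Ia /der_ideal_predP Ib]; apply/der_ideal_predP => //.
by apply: ID => //; rewrite -mulN1r; exact: IMl.
Qed.
HB.instance Definition _ :=
  GRing.isZmodClosed.Build A der_ideal_pred der_ideal_zmod_closed.

Definition der_quot : Type := (Quotient.quot der_ideal_pred).
HB.instance Definition _ := GRing.Zmodule.on der_quot.

Definition der_quot_pi (a : A) : der_quot := \pi_(Quotient.quot der_ideal_pred) a.

Lemma der_quot_piP a b : der_quot_pi a = der_quot_pi b <-> der_ideal_set I (a - b).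
Proof.
rewrite /der_quot_pi; split=> [/eqP|Iab].
  by rewrite -Quotient.idealrBE => /der_ideal_predP.
by apply/eqP; rewrite -Quotient.idealrBE; exact/der_ideal_predP.
Qed.

Lemma der_quot_pi_is_zmod_morphism : zmod_morphism der_quot_pi.
Proof. by move=> a b; rewrite /der_quot_pi raddfB. Qed.
HB.instance Definition _ := GRing.isZmodMorphism.Build A der_quot der_quot_pi
  der_quot_pi_is_zmod_morphism.

Definition der_quot_repr (x : der_quot) : A := repr (x : (Quotient.quot der_ideal_pred)).

Lemma der_quot_reprK : cancel der_quot_repr der_quot_pi.
Proof. by move=> x; exact: reprK. Qed.

Lemma der_quot_reprB a : der_ideal_set I (der_quot_repr (der_quot_pi a) - a).
Proof. by apply/der_quot_piP; rewrite der_quot_reprK. Qed.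

Definition der_quot_one : der_quot := der_quot_pi 1.
Definition der_quot_mul (x y : der_quot) : der_quot :=
  der_quot_pi (der_quot_repr x * der_quot_repr y).

Lemma der_quot_mulE a b :
  der_quot_mul (der_quot_pi a) (der_quot_pi b) = der_quot_pi (a * b).
Proof.
have [[_ ID IMl] [_ _ IMr]] := der_ideal_two_sided I.
apply/der_quot_piP; rewrite -[X in X - _](subrK (der_quot_repr (der_quot_pi a) * b)).
rewrite -addrA -mulrBr -mulrBl.
by apply: ID; [apply: IMl|apply: IMr]; exact: der_quot_reprB.
Qed.

Lemma der_quotP (P : der_quot -> Prop) : (forall a, P (der_quot_pi a)) -> forall x, P x.
Proof. by move=> Ppi x; rewrite -(der_quot_reprK x). Qed.

Lemma der_quot_mulA : associative der_quot_mul.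
Proof.
by do 3!elim/der_quotP=> ?; rewrite !der_quot_mulE mulrA.
Qed.

Lemma der_quot_mul1l : left_id der_quot_one der_quot_mul.
Proof. by elim/der_quotP=> a; rewrite der_quot_mulE mul1r. Qed.

Lemma der_quot_mul1r : right_id der_quot_one der_quot_mul.
Proof. by elim/der_quotP=> a; rewrite der_quot_mulE mulr1. Qed.

Lemma der_quot_mulDl : left_distributive der_quot_mul +%R.
Proof.
by do 3!elim/der_quotP=> ?; rewrite -raddfD !der_quot_mulE -raddfD mulrDl.
Qed.

Lemma der_quot_mulDr : right_distributive der_quot_mul +%R.
Proof.
by do 3!elim/der_quotP=> ?; rewrite -raddfD !der_quot_mulE -raddfD mulrDr.
Qed.

HB.instance Definition _ := GRing.Zmodule_isPzRing.Build der_quot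
  der_quot_mulA der_quot_mul1l der_quot_mul1r der_quot_mulDl der_quot_mulDr.

Lemma der_quot_pi_is_monoid_morphism : monoid_morphism der_quot_pi.
Proof. by split=> // a b; rewrite -der_quot_mulE. Qed.
HB.instance Definition _ := GRing.isMonoidMorphism.Build A der_quot der_quot_pi
  der_quot_pi_is_monoid_morphism.

Definition der_quot_der_fun (x : der_quot) : der_quot :=
  der_quot_pi (d (der_quot_repr x)).

Lemma der_quot_der_funE a : der_quot_der_fun (der_quot_pi a) = der_quot_pi (d a).
Proof.
apply/der_quot_piP; rewrite -raddfB.
exact/der_ideal_stable/der_quot_reprB.
Qed.

Lemma der_quot_derD x y :
  der_quot_der_fun (x + y) = der_quot_der_fun x + der_quot_der_fun y.
Proof.
elim/der_quotP: x => a; elim/der_quotP: y => b.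
by rewrite -raddfD !der_quot_der_funE derD raddfD.
Qed.

Lemma der_quot_derM x y :
  der_quot_der_fun (x * y) = der_quot_der_fun x * y + x * der_quot_der_fun y.
Proof.
elim/der_quotP: x => a; elim/der_quotP: y => b.
by rewrite -rmorphM !der_quot_der_funE derM raddfD -!rmorphM.
Qed.

Definition der_quot_der : derivation der_quot :=
  Derivation der_quot_derD der_quot_derM.

Lemma der_quot_derE a : der_quot_der (der_quot_pi a) = der_quot_pi (d a).
Proof. exact: der_quot_der_funE. Qed.

End Quotient.

Section GeneratedIdeal.
Variables (A : pzRingType) (d : derivation A) (S : set A).

(* Least two-sided d-stable ideal containing S, equal to S when S is already
   such an ideal (der_genK). It only serves to make the quotient below total. *)
Definition der_gen_set : set A :=
  [set a | forall I : der_ideal d, S `<=` I -> der_ideal_set I a].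

Lemma der_gen_two_sided : two_sided_ideal der_gen_set.
Proof.
split; split=> [I|a b Ia Ib I SI|r a Ia I SI].
all: have [[I0 ID IMl] [_ _ IMr]] := der_ideal_two_sided I => //.
all: by [apply: ID; [exact: Ia|exact: Ib] | apply: IMl; exact: Ia
        | apply: IMr; exact: Ia].
Qed.

Lemma der_gen_stable a : der_gen_set a -> der_gen_set (d a).
Proof. by move=> Ia I SI; apply: der_ideal_stable; exact: Ia. Qed.

Definition der_gen : der_ideal d := DerIdeal der_gen_two_sided der_gen_stable.

Lemma sub_der_gen : S `<=` der_gen.
Proof. by move=> a Sa I; exact. Qed.

End GeneratedIdeal.

Lemma der_genK (A : pzRingType) (d : derivation A) (I : der_ideal d) :
  der_gen d I = I :> set A.
Proof.
by apply/seteqP; split=> [a|]; [exact | exact: sub_der_gen].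
Qed.

Section TransfiniteSequence.
Variables (A : pzRingType) (d : derivation A).

(* The preimage in A of Il(A / I), for the induced derivation of A / I. *)
Definition Il_step (I : set A) : set A :=
  [set a | Il (der_quot_der (der_gen d I)) (der_quot_pi (der_gen d I) a)].

Section Stages.
(* An ordinal is represented by an element w of a well-ordered type W, and
   stands for the order type of its initial segment in W. *)
Variables (disp : Order.disp_t) (W : orderType disp).
Hypothesis wfW : well_founded (fun v w : W => (v < w)%O).

Definition is_zero (w : W) := forall v, (w <= v)%O.
Definition is_succ_of (w v : W) := (v < w)%O /\ forall u, (v < u)%O -> (w <= u)%O.

Definition Il_stage : W -> set A :=
  Fix wfW (fun=> set A) (fun w rec =>
    if `[< is_zero w >] then [set 0]
    else if `[< exists v, is_succ_of w v >] then
      [set a | exists v (lt_vw : (v < w)%O), is_succ_of w v /\ Il_step (rec v lt_vw) a]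
    else [set a | exists v (lt_vw : (v < w)%O), rec v lt_vw a]).

Lemma Il_stageE w : Il_stage w =
  if `[< is_zero w >] then [set 0]
  else if `[< exists v, is_succ_of w v >] then
    [set a | exists v, is_succ_of w v /\ Il_step (Il_stage v) a]
  else [set a | exists v, (v < w)%O /\ Il_stage v a].
Proof.
rewrite {1}/Il_stage Fix_eq => [|u f g efg]; last first.
  have -> : f = g by apply: functional_extensionality_dep => v; apply/funext => h.
  by [].
case: ifP => // _; case: ifP => // _; apply/seteqP; split=> a /=.
- by move=> [v [lt_vw [wv va]]]; exists v.
- by move=> [v [wv va]]; exists v, wv.1.
- by move=> [v [lt_vw va]]; exists v.
- by move=> [v [lt_vw va]]; exists v, lt_vw.
Qed.

Lemma Il_stage_zero w : is_zero w -> Il_stage w = [set 0].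
Proof. by move=> w0; rewrite Il_stageE asboolT. Qed.

Lemma Il_stage_succ w v : is_succ_of w v -> Il_stage w = Il_step (Il_stage v).
Proof.
move=> wv; rewrite Il_stageE ifF; last first.
  by apply/asboolP => /(_ v); rewrite leNgt wv.1.
rewrite asboolT; last by exists v.
apply/seteqP; split=> a /= => [[u [wu]]|va]; last by exists v.
suff -> : u = v by [].
have [lt_uv|lt_vu|//] := ltgtP u v.
  by have := wu.2 _ lt_uv; rewrite leNgt wv.1.
by have := wv.2 _ lt_vu; rewrite leNgt wu.1.
Qed.

Lemma Il_stage_limit w : ~ is_zero w -> ~ (exists v, is_succ_of w v) ->
  Il_stage w = \bigcup_(v in [set v | (v < w)%O]) Il_stage v.
Proof.
move=> nz ns; rewrite Il_stageE !asboolF //.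
apply/seteqP; split=> a /=; first by move=> [v [lt_vw va]]; exists v.
by move=> [v lt_vw va]; exists v.
Qed.

Lemma Il_step_two_sided I : two_sided_ideal (Il_step I).
Proof.
have [[I0 ID IMl] [_ _ IMr]] := Il_two_sided (der_quot_der (der_gen d I)).
split; split; rewrite /Il_step /= ?raddf0 // => a b; rewrite ?raddfD ?rmorphM.
- exact: ID.
- exact: IMl.
- exact: ID.
- exact: IMr.
Qed.

Lemma Il_step_stable I a : Il_step I a -> Il_step I (d a).
Proof. by rewrite /Il_step /= -der_quot_derE; exact: Il_der. Qed.

Lemma sub_Il_step I : I `<=` Il_step I.
Proof.
move=> a Ia; rewrite /Il_step /= (_ : der_quot_pi _ a = 0); first exact: Il0.
rewrite -(raddf0 (der_quot_pi _)); apply/der_quot_piP; rewrite subr0.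
exact: sub_der_gen.
Qed.

Let stages w : (exists I : der_ideal d, I = Il_stage w :> set A) /\
  forall v, (v < w)%O -> Il_stage v `<=` Il_stage w.
Proof.
elim/(well_founded_ind wfW): w => w IH.
have [w0|nw0] := pselect (is_zero w).
  split=> [|v]; last by rewrite ltNge w0.
  have ts : two_sided_ideal [set (0 : A)].
    by split; split=> //= [a b -> ->|r a ->]; rewrite ?addr0 ?mulr0 ?mul0r.
  have st : forall a, [set (0 : A)] a -> [set (0 : A)] (d a).
    by move=> a /= ->; rewrite raddf0.
  by exists (DerIdeal ts st); rewrite Il_stage_zero.
have [[v wv]|ns] := pselect (exists v, is_succ_of w v).
  rewrite (Il_stage_succ wv); split.
    by exists (DerIdeal (Il_step_two_sided (Il_stage v)) (@Il_step_stable (Il_stage v))).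
  move=> u lt_uw; apply: (subset_trans _ (@sub_Il_step (Il_stage v))).
  have [lt_uv|lt_vu|->//] := ltgtP u v; first exact: (IH _ wv.1).2.
  by have := wv.2 _ lt_vu; rewrite leNgt lt_uw.
rewrite (Il_stage_limit nw0 ns); split; last by move=> v lt_vw a va; exists v.
have mono u v a : (u < w)%O -> (v < w)%O -> (u <= v)%O -> Il_stage u a -> Il_stage v a.
  move=> _ lt_v; rewrite le_eqVlt => /orP[/eqP->//|lt_uv].
  exact: (IH v lt_v).2.
set U := \bigcup_(v in _) _.
have UP v : (v < w)%O -> two_sided_ideal (Il_stage v) /\
    forall a, Il_stage v a -> Il_stage v (d a).
  by move=> /IH[[[I ts st] /= <-] _].
have [v0 v0w] : exists v, (v < w)%O.
  by have /existsNP[v /negP] := nw0; rewrite -ltNge => ?; exists v.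
have U0 : U 0 by exists v0 => //; case: (UP _ v0w) => -[[]].
have UD a b : U a -> U b -> U (a + b).
  move=> [u uw ua] [v vw vb].
  have [le_uv|le_vu] := leP u v.
    exists v => //; case: (UP _ vw) => -[[_ + _] _] _; apply=> //.
    exact: mono le_uv ua.
  exists u => //; case: (UP _ uw) => -[[_ + _] _] _; apply=> //.
  exact: mono (ltW le_vu) vb.
have UMl r a : U a -> U (r * a).
  by move=> [v vw va]; exists v => //; case: (UP _ vw) => -[[_ _ +] _] _; apply.
have UMr r a : U a -> U (a * r).
  by move=> [v vw va]; exists v => //; case: (UP _ vw) => -[_ [_ _ +]] _; apply.
have Ud a : U a -> U (d a).
  by move=> [v vw va]; exists v => //; case: (UP _ vw) => _; apply.
by exists (DerIdeal (conj (And3 U0 UD UMl) (And3 U0 UD UMr)) Ud).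
Qed.

Lemma Il_stage_der_ideal w : exists I : der_ideal d, I = Il_stage w :> set A.
Proof. exact: (stages w).1. Qed.

Lemma der_gen_Il_stage w : der_gen d (Il_stage w) = Il_stage w :> set A.
Proof. by have [I <-] := Il_stage_der_ideal w; exact: der_genK. Qed.

Lemma Il_stage_le v w : (v <= w)%O -> Il_stage v `<=` Il_stage w.
Proof. by rewrite le_eqVlt => /orP[/eqP->//|]; exact: (stages w).2. Qed.

End Stages.

Definition P_der : set A :=
  [set a | exists (disp : Order.disp_t) (W : orderType disp)
             (wfW : well_founded (fun v w : W => (v < w)%O)) (w : W),
           Il_stage wfW w a].

Definition pdo_over (I : set A) : set (pdo d) :=
  [set f | forall i, I (pcoef f i)].

End TransfiniteSequence.

Arguments pdo_over {A} d I.

(* Main.v *)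
Require Import Defs.
From mathcomp Require Import all_boot all_order all_algebra all_classical.
From mathcomp Require Import zify.

(** Write S for the ring of series R((x^-1; delta)), and I((x^-1)) for the
    series with all coefficients in I. Both sides of the equality are shown to
    be M((x^-1)), where M is the largest delta-stable ideal inside the prime
    radical N of R.

    The chain condition provides a maximal nilpotent two-sided ideal. It is
    semiprime (noetherian_nilradical): if it contains a R a, adjoining a to it
    gives an ideal with square inside it, which is again nilpotent. A nilpotent
    semiprime ideal is the prime radical, so this ideal is N.

    The transfinite sequence is constant from its first stage on (P_derE).
    An element a outside a semiprime ideal N admits arbitrarily long products
    (a r_0) ... (a r_k) outside N, which is incompatible with T-nilpotence
    modulo an ideal inside N; hence no stage leaves N, and being delta-stable
    all stages lie in M. Conversely M is nilpotent and delta-stable, so it is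
    contained in the first stage.

    The inclusion of M((x^-1)) in the prime radical of S reflects the nilpotence
    of M (pdo_over_sub_prime_radical). For the other inclusion, M((x^-1)) is a
    semiprime ideal of S (pdo_over_der_core_semiprime): the leading coefficients
    of an ideal of S form a delta-stable ideal of R, so an ideal of S with square
    in M((x^-1)) has leading coefficients in M. In any ring a semiprime ideal
    contains the prime radical (prime_radical_semiprime). *)

Set Implicit Arguments.
Unset Strict Implicit.
Unset Printing Implicit Defensive.

Import Order.TTheory GRing.Theory Num.Theory.
Local Open Scope classical_set_scope.
Local Open Scope ring_scope.

(** * Semiprime ideals and the prime radical *)

Section Ideals.
Variable A : pzRingType.
Implicit Types (I J K N : set A) (a b r : A).

Lemma two_sided_idealB I a b : two_sided_ideal I -> I a -> I b -> I (a - b).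
Proof.
by move=> [[_ ID IMl] _] Ia Ib; apply: ID => //; rewrite -mulN1r; exact: IMl.
Qed.

Lemma two_sided_idealMn I a n : two_sided_ideal I -> I a -> I (a *+ n).
Proof. by move=> [[_ _ IMl] _] Ia; rewrite -mulr_natl; exact: IMl. Qed.

Lemma two_sided_idealMz I a m : two_sided_ideal I -> I a -> I (a *~ m).
Proof. by move=> [[_ _ IMl] _] Ia; rewrite -mulrzl; exact: IMl. Qed.

Lemma two_sided_ideal_sum I (T : Type) (l : seq T) (P : pred T) (F : T -> A) :
  two_sided_ideal I -> (forall i, P i -> I (F i)) -> I (\sum_(i <- l | P i) F i).
Proof. by move=> [[I0 ID _] _] IF; apply: big_ind. Qed.

Lemma two_sided_ideal0 : two_sided_ideal [set (0 : A)].
Proof.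
by split; split=> //= [a b -> ->|r a ->]; rewrite ?addr0 ?mulr0 ?mul0r.
Qed.

Definition ideal_add I J : set A := [set x + y | x in I & y in J].

Lemma ideal_add_two_sided I J :
  two_sided_ideal I -> two_sided_ideal J -> two_sided_ideal (ideal_add I J).
Proof.
move=> [[I0 ID IMl] [_ _ IMr]] [[J0 JD JMl] [_ _ JMr]].
have S0 : ideal_add I J 0 by exists 0 => //; exists 0; rewrite ?addr0.
have SD a b : ideal_add I J a -> ideal_add I J b -> ideal_add I J (a + b).
  move=> [x Ix [y Jy <-]] [x' Ix' [y' Jy' <-]].
  exists (x + x'); first exact: ID.
  by exists (y + y'); [exact: JD | rewrite addrACA].
split; split=> // r _ [x Ix [y Jy <-]].
  exists (r * x); first exact: IMl.
  by exists (r * y); [exact: JMl | rewrite mulrDr].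
exists (x * r); first exact: IMr.
by exists (y * r); [exact: JMr | rewrite mulrDl].
Qed.

Lemma sub_ideal_addl I J : two_sided_ideal J -> I `<=` ideal_add I J.
Proof. by move=> [[J0 _ _] _] a Ia; exists a => //; exists 0; rewrite ?addr0. Qed.

Lemma sub_ideal_addr I J : two_sided_ideal I -> J `<=` ideal_add I J.
Proof. by move=> [[I0 _ _] _] a Ja; exists 0 => //; exists a; rewrite ?add0r. Qed.

Definition principal_ideal a : set A :=
  sums [set y | exists r s, y = r * a * s].

Lemma principal_ideal_two_sided a : two_sided_ideal (principal_ideal a).
Proof.
split; split; do ?[exact: sums0 | by move=> *; exact: sumsD].
all: move=> r _ [l lP ->]; rewrite ?mulr_sumr ?mulr_suml big_seq.
all: apply: (big_ind (principal_ideal a)) => [|? ?|y /lP[u [v ->]]];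
  do ?[exact: sums0 | exact: sumsD]; apply: sums1.
  by exists (r * u), v; rewrite !mulrA.
by exists u, (v * r); rewrite !mulrA.
Qed.

Lemma mem_principal_ideal a : principal_ideal a a.
Proof. by apply: sums1; exists 1, 1; rewrite mul1r mulr1. Qed.

Definition semiprime_ideal K :=
  two_sided_ideal K /\ forall a, (forall r, K (a * r * a)) -> K a.

(** This turns the elementwise hypothesis a A a <= K into a statement about
    ideals: the ideal generated by K and a has its square in K. *)
Lemma square_extension K a :
  two_sided_ideal K -> (forall r, K (a * r * a)) ->
  exists I, [/\ two_sided_ideal I, K `<=` I, I a &
    forall x y, I x -> I y -> K (x * y)].
Proof.
move=> idK aKa; have idP := principal_ideal_two_sided a.
exists (ideal_add K (principal_ideal a)); split.
- exact: ideal_add_two_sided.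
- exact: sub_ideal_addl.
- by apply: sub_ideal_addr => //; exact: mem_principal_ideal.
move=> _ _ [x Kx [y Py <-]] [x' Kx' [y' Py' <-]].
have [[_ KD KMl] [_ _ KMr]] := idK.
rewrite mulrDl !mulrDr; apply: (KD); apply: (KD); [exact: KMr| exact: KMr
  | exact: KMl |].
case: Py Py' => l lP -> [l' lP' ->]; rewrite mulr_suml big_seq.
apply: two_sided_ideal_sum => // _ /lP[u [v ->]].
rewrite mulr_sumr big_seq; apply: two_sided_ideal_sum => // _ /lP'[u' [v' ->]].
rewrite (_ : _ * _ = u * (a * (v * u') * a) * v'); last by rewrite !mulrA.
exact/KMr/KMl.
Qed.

(** Zorn's lemma gives, for f outside K, an ideal Q containing K and maximal
    among those that avoid a sequence f, f r f, ... outside K in which each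
    term x is followed by some x r x. Such a Q is prime: two
    ideals strictly larger than Q both contain a common term x of the sequence,
    and their product contains the next one, x r x. *)
Lemma prime_radical_semiprime K : semiprime_ideal K -> prime_radical A `<=` K.
Proof.
move=> [idK sK] f Pf; apply: contrapT => nKf.
have /choice[r rP] : forall a, exists r, ~ K a -> ~ K (a * r * a).
  move=> a; have [Ka|nKa] := pselect (K a); first by exists 0.
  have /existsNP[r Kr] : ~ forall r, K (a * r * a) by move=> /sK.
  by exists r.
pose s n := iter n (fun a => a * r a * a) f.
have sS n : s n.+1 = s n * r (s n) * s n by [].
have nKs n : ~ K (s n) by elim: n => [//|n IH]; rewrite sS; exact: rP.
have sle X n m : two_sided_ideal X -> (n <= m)%N -> X (s n) -> X (s m).
  move=> [[_ _ XMl] _] /subnKC <- Xn; elim: (m - n)%N => [|k IH]; first by rewrite addn0.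
  by rewrite addnS sS; exact: XMl.
(* Zorn_bigcup also requires the union of the empty chain to qualify, hence the
   union with K. *)
pose good X := two_sided_ideal (K `|` X) /\ forall n, ~ (K `|` X) (s n).
have chain (F : set (set A)) : F `<=` good -> total_on F subset ->
    good (\bigcup_(X in F) X).
  move=> Fgood Ftot; split; last first.
    by move=> n [/nKs//|[X FX Xn]]; apply: (Fgood _ FX).2; right; exact: Xn.
  set U := \bigcup_(X in F) X.
  have XU X : F X -> K `|` X `<=` K `|` U.
    by move=> FX a [Ka|Xa]; [left | right; exists X].
  have K1 a : (K `|` U) a -> K a \/ exists2 X, F X & X a.
    by move=> [Ka|[X FX Xa]]; [left | right; exists X].
  have [[K0 KD KMl] [_ _ KMr]] := idK.
  have U0 : (K `|` U) 0 by left.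
  have UD a b : (K `|` U) a -> (K `|` U) b -> (K `|` U) (a + b).
    have XD X c d : F X -> (K `|` X) c -> (K `|` X) d -> (K `|` U) (c + d).
      move=> FX Xc Xd; apply: (XU _ FX).
      by have [[[_ XD _] _] _] := Fgood _ FX; exact: XD.
    move=> /K1[Ka|[X FX Xa]] /K1[Kb|[Y FY Yb]].
    - by left; exact: KD.
    - by apply: (XD _ _ _ FY); [left | right].
    - by apply: (XD _ _ _ FX); [right | left].
    - have [XY|YX] := Ftot _ _ FX FY.
        by apply: (XD _ _ _ FY); right => //; exact: XY.
      by apply: (XD _ _ _ FX); right => //; exact: YX.
  split; split=> // t a /K1[Ka|[X FX Xa]].
  - by left; exact: KMl.
  - apply: (XU _ FX); have [[[_ _ XMl] _] _] := Fgood _ FX.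
    by apply: XMl; right.
  - by left; exact: KMr.
  - apply: (XU _ FX); have [[_ [_ _ XMr]] _] := Fgood _ FX.
    by apply: XMr; right.
have [X [[idQ nQs] maxX]] := Zorn_bigcup chain.
set Q := K `|` X in idQ nQs.
have hit J : two_sided_ideal J -> ~ J `<=` Q -> exists n, ideal_add Q J (s n).
  move=> idJ nJQ; apply: contrapT => /forallNP nJs.
  have idQJ := ideal_add_two_sided idQ idJ.
  have QQJ := sub_ideal_addl (I := Q) idJ.
  apply: (maxX (ideal_add Q J)).
    split; first by move=> a Xa; apply: QQJ; right.
    move=> QJX; apply: nJQ => a Ja; right; apply: QJX.
    exact: sub_ideal_addr.
  have e : K `|` ideal_add Q J = ideal_add Q J.
    by apply/setUidPr => a Ka; apply: QQJ; left.
  by split; rewrite e.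
suff : prime_ideal Q by move=> /Pf; exact: (nQs 0%N).
split=> // [QT|I J idI idJ IJQ]; first by apply: (nQs 0%N); rewrite QT.
apply: contrapT => /not_orP[/(hit _ idI)[n In] /(hit _ idJ)[m Jm]].
apply: (nQs (maxn n m).+1); rewrite sS.
have {}In := sle _ _ _ (ideal_add_two_sided idQ idI) (leq_maxl n m) In.
have {}Jm := sle _ _ _ (ideal_add_two_sided idQ idJ) (leq_maxr n m) Jm.
have [_ [_ _ IrM]] := ideal_add_two_sided idQ idI.
have [x Qx [y Iy <-]] := IrM (r (s (maxn n m))) _ In.
have [x' Qx' [y' Jy' <-]] := Jm.
have [[_ QD QMl] [_ _ QMr]] := idQ.
rewrite mulrDl !mulrDr; apply: (QD); apply: (QD);
  [exact: QMr | exact: QMr | exact: QMl | exact: IJQ].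
Qed.

(** * Nilpotent ideals under the ascending chain condition *)

Definition nilpotent_set I :=
  exists n, forall s : nat -> A, (forall i, I (s i)) -> \prod_(i < n) s i = 0.

Lemma nilpotent_set_square I N : (forall x y, I x -> I y -> N (x * y)) ->
  nilpotent_set N -> nilpotent_set I.
Proof.
move=> IIN [n nilN]; exists (n * 2)%N => s sI.
rewrite -(nilN (fun i => s i.*2 * s i.*2.+1)) => [|i]; last exact: IIN.
elim: n {nilN} => [|n IH]; first by rewrite !big_ord0.
rewrite mulSn addnC addn2 !big_ord_recr /= IH -mulrA.
by rewrite muln2.
Qed.

(** Two-sided ideals are both left and right ideals, so each of the two chain
    conditions bounds their chains. *)
Lemma noetherian_maximal (P : set (set A)) J0 :
  left_noetherian A \/ right_noetherian A ->
  (forall J, P J -> two_sided_ideal J) -> P J0 ->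
  exists2 N, P N & forall J, P J -> N `<=` J -> J `<=` N.
Proof.
move=> noeth Pid PJ0; apply: contrapT => nmax.
have /choice[f fP] : forall J, exists J',
    P J -> [/\ P J', J `<=` J' & ~ J' `<=` J].
  move=> J; have [PJ|nPJ] := pselect (P J); last by exists J.
  apply: contrapT => /forallNP nJ; apply: nmax; exists J => // J' PJ' JJ'.
  by apply: contrapT => nJ'J; apply: (nJ J').
pose I n := iter n f J0.
have PI n : P (I n) by elim: n => [//|n IH]; have [] := fP _ IH.
have IS n : I n `<=` I n.+1 by have [] := fP _ (PI n).
have [n stop] : exists n, forall m, (n <= m)%N -> I m = I n.
  by case: noeth => noeth; apply: noeth => // n; case: (Pid _ (PI n)).
have [_ _] := fP _ (PI n).
by rewrite -[f (I n)]/(I n.+1) stop //; apply.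
Qed.

Lemma noetherian_nilradical : left_noetherian A \/ right_noetherian A ->
  exists2 N, semiprime_ideal N & nilpotent_set N.
Proof.
move=> noeth.
have [J []//||N [idN nilN] maxN] :=
    @noetherian_maximal [set I | two_sided_ideal I /\ nilpotent_set I] [set 0] noeth.
  split; first exact: two_sided_ideal0.
  by exists 1%N => s s0; rewrite big_ord1; exact: s0.
exists N => //; split=> // a aNa.
have [I [idI NI Ia IIN]] := square_extension idN aNa.
apply: (maxN I) => //; split=> //; exact: nilpotent_set_square nilN.
Qed.

(** The left annihilator of the j-th power of M, reached without forming that
    power: for nilpotent M this is a series of ideals from 0 up to the whole
    ring, whose successive quotients are killed by M on the right. *)
Fixpoint ann_seq (M : set A) (j : nat) : set A :=
  if j is k.+1 then [set a | forall m, M m -> ann_seq M k (a * m)] else [set 0].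

Lemma ann_seq_nilpotent M : M 0 -> nilpotent_set M -> exists n, ann_seq M n = setT.
Proof.
move=> M0 [n nilM]; exists n.
have annP j a : (forall s : nat -> A, (forall i, M (s i)) ->
    a * \prod_(i < j) s i = 0) -> ann_seq M j a.
  elim: j a => [|j IH] a aM /=.
    by rewrite -(aM (fun=> 0)) // big_ord0 mulr1.
  move=> m Mm; apply: IH => s sM.
  rewrite -(aM (fun i => if i is k.+1 then s k else m)); last by case.
  by rewrite big_ord_recl mulrA.
by apply/seteqP; split=> // a _; apply: annP => s sM; rewrite nilM // mulr0.
Qed.

End Ideals.

(** * The ideal P_der in terms of a nilpotent semiprime ideal *)

Section DerivationIdeals.
Variables (A : pzRingType) (d : derivation A).
Implicit Types (I M N : set A) (a b : A).

Lemma ann_seq_two_sided M j : two_sided_ideal M -> two_sided_ideal (ann_seq M j).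
Proof.
move=> [[_ _ MMl] _].
elim: j => [|j [[I0 ID IMl] [_ _ IMr]]]; first exact: two_sided_ideal0.
split; split=> [m _|a b Ia Ib m Mm|r a Ia m Mm]; rewrite ?mul0r // ?mulrDl.
all: try by apply: ID; [exact: Ia | exact: Ib].
  by rewrite -mulrA; exact/IMl/Ia.
by rewrite -mulrA; exact/Ia/MMl.
Qed.

Lemma ann_seq_der M j a : two_sided_ideal M -> (forall a, M a -> M (d a)) ->
  ann_seq M j a -> ann_seq M j (d a).
Proof.
move=> idM dM; elim: j a => [a ->|j IH a Ia m Mm] /=; first exact: raddf0.
rewrite (_ : d a * m = d (a * m) - a * d m); last by rewrite derM addrK.
apply: two_sided_idealB; first exact: ann_seq_two_sided.
  exact/IH/Ia.
exact/Ia/dM.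
Qed.

(** The largest d-stable ideal contained in N. *)
Definition der_core N : set A := [set a | forall i, N (iter i d a)].

Lemma der_core_sub N : der_core N `<=` N.
Proof. by move=> a /(_ 0%N). Qed.

Lemma der_core_two_sided N : two_sided_ideal N -> two_sided_ideal (der_core N).
Proof.
move=> idN; have [[N0 ND NMl] [_ _ NMr]] := idN.
split; split=> [i|a b Na Nb i|r a Na i]; rewrite ?raddf0 ?raddfD ?iter_derM //.
- by apply: ND; [exact: Na | exact: Nb].
- by apply: two_sided_ideal_sum => // k _; apply: two_sided_idealMn => //; exact/NMl/Na.
- by apply: ND; [exact: Na | exact: Nb].
- by apply: two_sided_ideal_sum => // k _; apply: two_sided_idealMn => //; exact/NMr/Na.
Qed.

Lemma der_core_stable N a : der_core N a -> der_core N (d a).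
Proof. by move=> Na i; rewrite -iterSr. Qed.

(** If a were outside N, one could choose r_0, r_1, ... with all products
    a r_0 a r_1 ... a r_k a outside N, by semiprimeness; but the elements a r_i
    lie in the right ideal attached to a, which is left T-nilpotent modulo I. *)
Lemma Il_step_semiprime N I :
  semiprime_ideal N -> der_gen d I `<=` N -> Il_step d I `<=` N.
Proof.
move=> [idN sN] IN a Ia; apply: contrapT => nNa.
have [[_ _ NMl] [_ _ NMr]] := idN.
(* Semiprimeness gives p r p outside N; if p = a q then p r p = (p r a) q, so
   p r a is outside N as well. *)
have /choice[r rP] : forall p, exists r,
    ~ N p -> (exists q, p = a * q) -> ~ N (p * r * a).
  move=> p; have [[nNp [q pE]]|np] := pselect (~ N p /\ exists q, p = a * q);
    last by exists 0 => nNp pE; case: np.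
  have /existsNP[r Nr] : ~ forall r, N (p * r * p) by move=> /sN.
  exists r => _ _ Npra; apply: Nr.
  by rewrite [X in _ * _ * X]pE mulrA; exact: NMr.
pose p n := iter n (fun p => p * r p * a) a.
have pa n : exists q, p n = a * q.
  elim: n => [|n [q pE]]; first by exists 1; rewrite mulr1.
  by exists (q * r (p n) * a); rewrite !mulrA -pE.
have nNp n : ~ N (p n) by elim: n => [//|n IH]; exact: rP.
have pE n : p n = \prod_(i < n) (a * r (p i)) * a.
  elim: n => [|n IH]; first by rewrite big_ord0 mul1r.
  by rewrite big_ord_recr /= mulrA -IH.
have [i|k _ k0] := Ia (fun i => der_quot_pi (der_gen d I) (a * r (p i))).
  by rewrite rmorphM; exact: (der_right_ideal_iter _ _ 0).
apply: (nNp k); rewrite pE; apply/NMr/IN; rewrite -[\prod_(i < k) _]subr0.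
by apply/der_quot_piP; rewrite rmorph_prod raddf0.
Qed.

(** The right ideal attached to an element of M stays inside M, and in a
    nilpotent ideal every sequence has vanishing products of a fixed length. *)
Lemma sub_Il_step_nilpotent M : two_sided_ideal M ->
  (forall a, M a -> M (d a)) -> nilpotent_set M -> M `<=` Il_step d [set 0].
Proof.
move=> idM dM [n nilM] a Ma s sT.
pose pi := der_quot_pi (der_gen d [set 0]).
have /choice[t /all_and2[Mt st]] : forall i, exists t, M t /\ s i = pi t.
  move=> i; have [k [r ->]] := sT i.
  exists (\sum_(j < k) iter j d a * der_quot_repr (r j)); split.
    apply: two_sided_ideal_sum => // j _; have [_ [_ _ MMr]] := idM.
    by apply: MMr; elim: (nat_of_ord j) => [|l IH]; [|exact: dM].
  rewrite /pi raddf_sum; apply: eq_bigr => j _; rewrite /= rmorphM /= der_quot_reprK.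
  congr (_ * _); elim: (nat_of_ord j) => [//|l IH].
  by rewrite !iterS IH der_quot_der_funE.
exists n.+1 => //; rewrite big_ord_recr /= (_ : \prod_(i < n) s i = 0) ?mul0r //.
transitivity (pi (\prod_(i < n) t i)); last by rewrite nilM // /pi raddf0.
by rewrite /pi rmorph_prod; apply: eq_bigr => i _.
Qed.

Lemma Il_stage_semiprime (disp : Order.disp_t) (W : orderType disp)
    (wfW : well_founded (fun v w : W => (v < w)%O)) N (w : W) :
  semiprime_ideal N -> Il_stage d wfW w `<=` N.
Proof.
move=> sN; elim/(well_founded_ind wfW): w => w IH.
have [w0|nw0] := pselect (is_zero w).
  by rewrite Il_stage_zero // => _ ->; have [[[]]] := sN.
have [[v wv]|ns] := pselect (exists v, is_succ_of w v).
  rewrite (Il_stage_succ _ _ wv); apply: Il_step_semiprime => //.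
  by rewrite der_gen_Il_stage; apply: IH; exact: wv.1.
rewrite (Il_stage_limit _ _ nw0 ns) => a [v vw]; exact: IH.
Qed.

Lemma Il_step0_sub_P_der : Il_step d [set 0] `<=` P_der d.
Proof.
have wfb : well_founded (fun v w : bool => (v < w)%O).
  by case; constructor; case=> // _; constructor; case.
(* In the two-element order, true stands for the ordinal 1. *)
exists _, bool, wfb, true.
rewrite (@Il_stage_succ _ _ _ _ wfb true false); last by split=> //; case.
by rewrite Il_stage_zero.
Qed.

(** No stage leaves N, and the stages are d-stable, so they stay in der_core N;
    this core is nilpotent, hence already contained in the first stage. *)
Lemma P_derE N : semiprime_ideal N -> nilpotent_set N -> P_der d = der_core N.
Proof.
move=> sN [n nilN]; apply/seteqP; split=> [a [disp [W [wfW [w wa]]]] i|a Na].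
  have [I IE] := Il_stage_der_ideal d wfW w.
  apply: (Il_stage_semiprime sN (wfW := wfW) (w := w)); rewrite -IE in wa *.
  by elim: i => [//|i IH]; exact: der_ideal_stable.
apply: Il_step0_sub_P_der; move: a Na; apply: sub_Il_step_nilpotent.
- exact/der_core_two_sided/(sN.1).
- exact: der_core_stable.
- by exists n => s sN'; apply: nilN => i; exact: der_core_sub (sN' i).
Qed.

End DerivationIdeals.

(** * Ideals of the ring of pseudo-differential operators *)

Section PseudoDifferentialIdeals.
Variables (A : pzRingType) (d : derivation A).
Implicit Types (I M N : set A) (f g : pdo d).

Lemma pdo_over_mul I f g : two_sided_ideal I ->
  (forall i j k, I (pcoef f i * iter k d (pcoef g j))) -> pdo_over d I (f * g).
Proof.
move=> idI Ifg n; rewrite pcoefM; apply: two_sided_ideal_sum => // p _.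
exact: two_sided_idealMz.
Qed.

Lemma pdo_over_two_sided I : two_sided_ideal I ->
  (forall a, I a -> I (d a)) -> two_sided_ideal (pdo_over d I).
Proof.
move=> idI dI; have [[I0 ID IMl] [_ _ IMr]] := idI.
have dIn a k : I a -> I (iter k d a) by move=> Ia; elim: k => //= k; exact: dI.
split; split=> // [f g If Ig i|r f If]; do ?exact: ID.
- by apply: pdo_over_mul => // i j k; exact/IMl/dIn.
- by apply: pdo_over_mul => // i j k; exact: IMr.
Qed.

(** Each ann_seq M (j.+1) ((x^-1)) times M((x^-1)) lies in the previous one, so
    walking up the series from 0, a prime that does not contain M((x^-1)) must
    contain each term in turn; but the last term is the whole ring. *)
Lemma pdo_over_sub_prime_radical M : two_sided_ideal M ->
  (forall a, M a -> M (d a)) -> nilpotent_set M ->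
  pdo_over d M `<=` prime_radical (pdo d).
Proof.
move=> idM dM nilM f Mf Q [idQ nQT primeQ].
have [[Q0 _ _] _] := idQ; have [[M0 _ _] _] := idM.
have dMn a k : M a -> M (iter k d a) by move=> Ma; elim: k => //= k; exact: dM.
apply: contrapT => nQf.
have annQ j : pdo_over d (ann_seq M j) `<=` Q.
  elim: j => [g g0|j IH]; first by rewrite (_ : g = 0) //; exact: pdoP.
  have idann i : two_sided_ideal (pdo_over d (ann_seq M i)).
    apply: pdo_over_two_sided => [|a]; first exact: ann_seq_two_sided.
    exact: ann_seq_der.
  have [|//|MQ] := primeQ _ _ (idann j.+1) (pdo_over_two_sided idM dM).
    move=> g h annj Mh; apply: IH; apply: pdo_over_mul => [|i l k].
      exact: ann_seq_two_sided.
    exact/annj/dMn.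
  by case: nQf; exact: MQ.
have [n annT] := ann_seq_nilpotent M0 nilM.
by apply: nQT; apply/seteqP; split=> // g _; apply: (annQ n); rewrite annT.
Qed.

Lemma pcoef_mul_monom f m n : pcoef (f * pdo_monom d m) n = pcoef f (n - m).
Proof.
rewrite pcoefM (fsbigE [:: (n - m, 0%N)]) //= => [|[i k] _ /=].
  rewrite big_cons big_nil in_setT /= addr0 binz0 mulr1z.
  by rewrite (_ : _ == m = true) ?mulr1 //; lia.
rewrite inE xpair_eqE; case: k => [|k].
  rewrite eqxx andbT => ne_i; rewrite (_ : _ == m = false) ?mulr0 ?mul0rz //=.
  lia.
by case: (_ == m) => _; rewrite ?iter_der1 ?raddf0 mulr0 mul0rz.
Qed.

Lemma pcoef_monom1_mul f n :
  pcoef (pdo_monom d 1 * f) n = pcoef f (n - 1) + d (pcoef f n).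
Proof.
rewrite pcoefM (fsbigE [:: (1, 0%N); (1, 1%N)]) //= => [|[i k] _ /=].
  rewrite !big_cons big_nil !in_setT /= addr0 !mulr1z !mul1r.
  by rewrite addr0 addrK.
have [->|] := eqVneq i 1; last by rewrite mul0r mul0rz.
by case: k => [|[|k]] //= _; rewrite bin_small ?mulr0z.
Qed.

Lemma pcoef0_mul f g : pbound f 0 -> pbound g 0 ->
  pcoef (f * g) 0 = pcoef f 0 * pcoef g 0.
Proof.
move=> f0 g0; have := @pdo_mul_conv _ _ _ _ _ _ 1 0 f0 g0 isT.
by rewrite /conv !big_ord1 /= !subr0 mulr1z mulr1n.
Qed.

(** Put M = der_core d N and K = M((x^-1)). If f S f is in K, the ideal I
    spanned by K and f has its square in K. The coefficients at x^0 of the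
    g in I of degree at most 0 form an ideal, stable under d because x g - g x
    is g differentiated coefficientwise, and with square in M. Semiprimeness of
    N puts this ideal inside M, and then the coefficients of f are found in M
    one after the other, from the top: removing those already in M and shifting
    leaves the next one at x^0. *)
Lemma pdo_over_der_core_semiprime N :
  semiprime_ideal N -> semiprime_ideal (pdo_over d (der_core d N)).
Proof.
move=> [idN sN]; set M := der_core d N.
have idK : two_sided_ideal (pdo_over d M).
  by apply: pdo_over_two_sided; [exact: der_core_two_sided | exact: der_core_stable].
split=> // f /(square_extension idK)[I [idI KI If IIK]].
have [[_ _ IMl] [_ _ IMr]] := idI.
have M0 : M 0 by have [[]] := der_core_two_sided d idN.
have derI g : I g -> pbound g 0 ->
    exists h, [/\ I h, pbound h 0 & pcoef h 0 = d (pcoef g 0)].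
  move=> Ig g0; exists (pdo_monom d 1 * g - g * pdo_monom d 1).
  have hE i : pcoef (pdo_monom d 1 * g - g * pdo_monom d 1) i = d (pcoef g i).
    rewrite pcoefD pcoef_monom1_mul.
    rewrite -[pcoef (- _) i]/(- pcoef (g * pdo_monom d 1) i).
    by rewrite pcoef_mul_monom addrAC subrr add0r.
  split=> [||//]; last by move=> i /g0; rewrite hE => ->; exact: raddf0.
  by apply: two_sided_idealB => //; [exact: IMl | exact: IMr].
have leadM g : I g -> pbound g 0 -> M (pcoef g 0).
  move=> Ig g0 i; have [h [Ih h0 <-]] : exists h,
      [/\ I h, pbound h 0 & pcoef h 0 = iter i d (pcoef g 0)].
    elim: i => [|i [h [Ih h0 hE]]]; first by exists g.
    by rewrite iterS -hE; exact: derI.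
  apply: sN => r; apply: (der_core_sub (d := d)).
  have r0 : pbound (pdo_const d r) 0 by move=> j j0 /=; rewrite gt_eqF.
  have hr0 : pbound (h * pdo_const d r) 0.
    by rewrite -[0]addr0; exact: pbound_mul.
  have : M (pcoef (h * pdo_const d r * h) 0).
    by apply: IIK => //; exact: IMr.
  by rewrite !pcoef0_mul //= mulr1n.
have [n fn] := pcoef_bounded f.
suff Mf (t : nat) : M (pcoef f (n - t%:Z)).
  move=> i; have [le_in|/fn ->] := leP i n; last exact: M0.
  by have -> : i = n - `|n - i|%N%:Z by lia.
elim/ltn_ind: t => t IH; set c := n - t%:Z.
have hB : exists m, forall i, m < i -> pcoef f i *+ (c < i)%R = 0.
  by exists n => i /fn ->; rewrite mul0rn.
pose h : pdo d := PDO d hB.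
have Mh : pdo_over d M h.
  move=> i /=; have [lt_ci|_] := ltP c i; last exact: M0.
  rewrite mulr1n; have [le_in|/fn ->] := leP i n; last exact: M0.
  have -> : i = n - `|n - i|%N%:Z by lia.
  by apply: IH; rewrite /c in lt_ci; lia.
have Igh : I (f - h) by apply: two_sided_idealB => //; exact: KI.
have ghE i : pcoef ((f - h) * pdo_monom d (- c)) i =
    pcoef f (i + c) - pcoef f (i + c) *+ (c < i + c)%R.
  by rewrite pcoef_mul_monom opprK.
have -> : pcoef f c = pcoef ((f - h) * pdo_monom d (- c)) 0.
  by rewrite ghE add0r ltxx subr0.
apply: leadM; first exact: IMr.
by move=> i i0; rewrite ghE ltrDr i0 subrr.
Qed.

End PseudoDifferentialIdeals.

Theorem proposition2p12 (R : pzRingType) (delta : derivation R)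
    (noeth : left_noetherian R \/ right_noetherian R) :
  prime_radical (pdo delta) = pdo_over delta (P_der delta).
Proof.
have [N sN nilN] := noetherian_nilradical noeth.
rewrite (P_derE delta sN nilN); apply/seteqP; split.
  by apply: prime_radical_semiprime; exact: pdo_over_der_core_semiprime.
apply: pdo_over_sub_prime_radical; first exact/der_core_two_sided/sN.1.
  exact: der_core_stable.
have [n nil_n] := nilN; exists n => s Ms.
by apply: nil_n => i; exact: der_core_sub (Ms i).
Qed.
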